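(* Fix an integer $p \geq 2$ and subsets $X, Y \subset \mathbb{R}$, each of size at least $p$. Let $\Omega(x) := x e^{-x}$ for $x>0$ and $\Omega(x) := 0$ for $x \leq 0$, and let $W(x) := \cos x$ for $x \in (-\pi/2,\pi/2)$ and $W(x) := 0$ otherwise. \begin{enumerate} \item There exists $a = a(X,Y) \in \mathbb{R}$ such that for every $\alpha \in (0,p-2)\setminus \mathbb{Z}$, the kernel $X \times Y \to \mathbb{R}$, $(x,y) \mapsto \Omega(x-y-a)^\alpha$, is not $\mathrm{TN}_p$. \item There exists $m = m(X,Y) \in (0,\infty)$ such that for every $\alpha \in (0,p-2)\setminus\mathbb{Z}$, the kernel $X \times Y \to \mathbb{R}$, $(x,y) \mapsto W(m(x-y))^\alpha$, is not $\mathrm{TN}_p$. \item Given tuples $\mathbf{x}, \mathbf{y} \in \operatorname{inc}(\mathbb{R},p)$, there exist $a \in \mathbb{R}$ and $m > 0$ (independent of $\alpha$) such that for every $\alpha \geq 0$ the $p\times p$ matrices $(\Omega(x_j - y_k - a)^\alpha)_{j,k=1}^p$ and $(W(m(x_j-y_k))^\alpha)_{j,k=1}^p$ are $\mathrm{TP}$ if $\alpha > p-2$, are $\mathrm{TN}$ if $\alpha \in \{0,1,\dots,p-2\}$, and are not $\mathrm{TN}$ if $\alpha \in (0,p-2)\setminus\mathbb{Z}$. \end{enumerate}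
   Context: For a totally ordered set $X$ and integer $r \geq 1$, $\operatorname{inc}(X,r)$ denotes the set of $r$-tuples $(x_1,\dots,x_r) \in X^r$ with $x_1 < \cdots < x_r$. For $X,Y \subset \mathbb{R}$, a kernel $K : X \times Y \to \mathbb{R}$ is $\mathrm{TN}_p$ (totally non-negative of order $p$) if $\det (K(x_j,y_k))_{j,k=1}^r \geq 0$ for all $1 \leq r \leq p$ and all $\mathbf{x} \in \operatorname{inc}(X,r)$, $\mathbf{y} \in \operatorname{inc}(Y,r)$; it is $\mathrm{TP}_p$ if all these determinants are $>0$; it is $\mathrm{TN}$ (resp. $\mathrm{TP}$) if it is $\mathrm{TN}_p$ (resp. $\mathrm{TP}_p$) for all $p\ge1$. A real matrix is $\mathrm{TN}$/$\mathrm{TP}$ if all its minors (of all orders) are $\geq 0$ / $>0$. Convention: $0^0 := 0$. *)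

(* Defs.v *)
From HB Require Import structures.
From mathcomp Require Import all_boot all_order all_algebra.
From mathcomp Require Import all_classical all_reals all_analysis.
Set Implicit Arguments. Unset Strict Implicit. Unset Printing Implicit Defensive.
Import Order.TTheory GRing.Theory Num.Theory.
Local Open Scope ring_scope.
Local Open Scope classical_set_scope.

Section Defs.
Variable R : realType.

(* real power with the convention 0^0 := 0; only applied to nonnegative bases *)
Definition rpow (x a : R) : R := if 0 < x then x `^ a else 0.

Definition Omega (x : R) : R := if 0 < x then x * expR (- x) else 0.

Definition Wfun (x : R) : R :=
  if (- (pi / 2) < x) && (x < pi / 2) then cos x else 0.

Definition inc (X : set R) (r : nat) (x : 'I_r -> R) : Prop :=
  (forall i, X (x i)) /\ (forall i j : 'I_r, (i < j)%N -> x i < x j).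

Definition kernel_TN (p : nat) (X Y : set R) (K : R -> R -> R) : Prop :=
  forall (r : nat), (1 <= r <= p)%N ->
  forall (x y : 'I_r -> R), inc X x -> inc Y y ->
    0 <= \det (\matrix_(j < r, k < r) K (x j) (y k)).

Definition incr_idx (r n : nat) (f : 'I_r -> 'I_n) : Prop :=
  forall i j : 'I_r, (i < j)%N -> (f i < f j)%N.

Definition minor (m n r : nat) (A : 'M[R]_(m, n)) (f : 'I_r -> 'I_m)
  (g : 'I_r -> 'I_n) : R := \det (\matrix_(i < r, j < r) A (f i) (g j)).

Definition TNmx (m n : nat) (A : 'M[R]_(m, n)) : Prop :=
  forall (r : nat) (f : 'I_r -> 'I_m) (g : 'I_r -> 'I_n),
    (0 < r)%N -> incr_idx f -> incr_idx g -> 0 <= minor A f g.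

Definition TPmx (m n : nat) (A : 'M[R]_(m, n)) : Prop :=
  forall (r : nat) (f : 'I_r -> 'I_m) (g : 'I_r -> 'I_n),
    (0 < r)%N -> incr_idx f -> incr_idx g -> 0 < minor A f g.

Definition size_ge (X : set R) (p : nat) : Prop :=
  exists f : 'I_p -> R, injective f /\ (forall i, X (f i)).

Definition is_integer (a : R) : Prop := exists z : int, a = z%:~R.

End Defs.

(* Main.v *)
(** Up to positive row and column factors, both matrices become Jain's matrix
    [(1 + u_j v_k)^alpha] with [u], [v] positive and increasing, once all arguments
    are moved into the positivity region.  The sign of its determinant of size [n+1]
    is that of [\prod_(i < n) (alpha - i)^(n - i)] for every real [alpha].  Indeed,
    divide row [j] by its first entry and subtract consecutive rows; applying the mean
    value theorem to one row at a time turns the differences into derivatives at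
    interlacing points, and the derivative of
    [(1 + t v_k)^alpha (1 + t v_0)^(-alpha)] is
    [alpha (v_k - v_0) (1 + t v_0)^(-alpha-1) (1 + t v_k)^(alpha-1)], so that Jain's
    matrix of size [n] and exponent [alpha - 1] reappears.  For non-integral [alpha]
    with integer part [n <= p - 3], the minors of size [n + 3] are therefore negative. *)
Require Import Defs.
From HB Require Import structures.
From mathcomp Require Import all_boot all_order all_algebra.
From mathcomp Require Import all_classical all_reals all_analysis.
From mathcomp Require Import ring lra.
Import Order.TTheory GRing.Theory Num.Theory.
Local Open Scope ring_scope.
Local Open Scope classical_set_scope.

(** * Determinants: scaling, row differences and a mean value theorem *)

Lemma det_scale_rows_cols (R : comPzRingType) (n : nat) (c d : 'I_n -> R)
    (A : 'I_n -> 'I_n -> R) :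
  \det (\matrix_(i, j) (c i * d j * A i j)) =
  (\prod_i c i) * (\prod_j d j) * \det (\matrix_(i, j) A i j).
Proof.
have -> : \matrix_(i, j) (c i * d j * A i j) =
    diag_mx (\row_i c i) *m (\matrix_(i, j) A i j) *m diag_mx (\row_j d j).
  by apply/matrixP => i j; rewrite mul_diag_mx mul_mx_diag !mxE mulrAC.
rewrite !det_mulmx !det_diag mulrAC.
by congr (_ * _ * _); apply: eq_bigr => i _; rewrite mxE.
Qed.

Lemma det_col0_ones (R : comPzRingType) (n : nat) (h : 'I_n.+1 -> 'I_n.+1 -> R) :
  (forall i, h i ord0 = 1) ->
  \det (\matrix_(i, j) h i j) =
  \det (\matrix_(i < n, j < n) (h (lift ord0 i) (lift ord0 j) -
                               h (widen_ord (leqnSn n) i) (lift ord0 j))).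
Proof.
move=> h1.
(* Left multiplication by the unit lower bidiagonal [L] subtracts from each row its predecessor and
   keeps row 0; the first column then becomes the first unit vector, and expansion along it leaves
   the differences. *)
pose L : 'M[R]_n.+1 :=
  \matrix_(i, j) ((i == j)%:R - (i == j.+1 :> nat)%:R).
have detL : \det L = 1.
  rewrite det_trig; last first.
    apply/is_trig_mxP => i j ij; rewrite mxE.
    rewrite (_ : i == j = false); last by apply/eqP=> E; move: ij; rewrite E ltnn.
    by rewrite ltn_eqF ?subr0// ltnW.
  by rewrite big1// => i _; rewrite mxE eqxx (ltn_eqF (ltnSn i)) subr0.
have LE i j : (L *m \matrix_(i, j) h i j) i j =
    h i j - (if unlift ord0 i is Some k then h (widen_ord (leqnSn n) k) j else 0).
  rewrite mxE; under eq_bigr do rewrite !mxE mulrBl; rewrite sumrB; congr (_ - _).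
    by rewrite (bigD1 i)//= eqxx mul1r big1 ?addr0// => k /negPf;
       rewrite eq_sym => ->; rewrite mul0r.
  case: unliftP => [k ->|->]; last by rewrite big1// => k _; rewrite mul0r.
  rewrite (bigD1 (widen_ord (leqnSn n) k))//= /bump add1n eqxx mul1r big1 ?addr0//.
  move=> l /negPf lk; rewrite eqSS (_ : (k == l :> nat) = false) ?mul0r//.
  by apply/negbTE; apply: contraFN lk => /eqP kl; apply/eqP/val_inj.
rewrite -[LHS]mul1r -detL -det_mulmx (expand_det_col _ ord0) big_ord_recl.
rewrite LE unlift_none subr0 h1 mul1r big1 ?addr0; last first.
  by move=> i _; rewrite LE liftK !h1 subrr mul0r.
rewrite /cofactor expr0 mul1r; congr (\det _).
by apply/matrixP => i j; rewrite [LHS]mxE [LHS]mxE LE liftK mxE.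
Qed.

(** The determinant is linear in each row, so with the other rows fixed it is one scalar combination
    of the [g k]. The ordinary mean value theorem for that combination yields a single intermediate
    point for the whole row. *)
Lemma det_mean_value (R : realType) (n : nat) (g dg : 'I_n -> R -> R)
    (a b : 'I_n -> R) :
  (forall i, a i < b i) ->
  (forall i k x, a i <= x <= b i -> is_derive x 1 (g k) (dg k x)) ->
  exists xi : 'I_n -> R, (forall i, a i < xi i < b i) /\
    \det (\matrix_(i, k) (g k (b i) - g k (a i))) =
    (\prod_i (b i - a i)) * \det (\matrix_(i, k) dg k (xi i)).
Proof.
move=> ab gdg.
(* In [M m xi] the first [m] rows of differences have been replaced by derivatives. *)
pose M m (xi : 'I_n -> R) : 'M[R]_n := \matrix_(i, k)
  if (i < m)%N then (b i - a i) * dg k (xi i) else g k (b i) - g k (a i).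
suff /(_ n (leqnn n)) [xi [xiab ->]] : forall m, (m <= n)%N ->
    exists xi : 'I_n -> R, (forall i, a i < xi i < b i) /\
      \det (\matrix_(i, k) (g k (b i) - g k (a i))) = \det (M m xi).
  exists xi; split => //.
  (* A product of trivial column factors is inserted to match [det_scale_rows_cols]. *)
  rewrite -[\prod_i _]mulr1 -[X in _ * X * _](@big1_eq _ 1 *%R _ (enum 'I_n) predT).
  rewrite big_enum -det_scale_rows_cols; congr (\det _).
  by apply/matrixP => i k; rewrite !mxE ltn_ord mulr1.
elim=> [|m IH] mn.
  exists (fun i => (a i + b i) / 2); split.
    by move=> i; have := ab i; lra.
  by congr (\det _); apply/matrixP => i k; rewrite !mxE.
have [xi [xiab ->]] := IH (ltnW mn).
pose i0 := Ordinal mn.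
(* These cofactors do not see row [i0], so they stay the same when that row is evaluated at another
   point; [phi] is the expansion along it. *)
pose C k := cofactor (M m xi) i0 k.
pose phi : R -> R := \sum_(k < n) (C k *: g k).
pose dphi (t : R) : R := \sum_(k < n) (C k *: dg k t).
have dphiE t : a i0 <= t <= b i0 -> is_derive t 1 phi (dphi t).
  by move=> tab; apply: is_derive_sum => k; apply: is_deriveZ; exact: gdg tab.
have [||c cab phic] := @MVT R phi dphi (a i0) (b i0) (ab i0).
- move=> t; rewrite in_itv/= => /andP[t1 t2]; apply: dphiE.
  by rewrite !ltW.
- apply: derivable_within_continuous => t; rewrite in_itv/= => tab.
  by have ? := dphiE t tab; exact: ex_derive.
exists (fun i => if i == i0 then c else xi i); split.
  by move=> i; case: eqP => [->|_]; [move: cab; rewrite in_itv|exact: xiab].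
rewrite !(expand_det_row _ i0).
transitivity (phi (b i0) - phi (a i0)).
  rewrite /phi !fct_sumE -sumrB; apply: eq_bigr => k _.
  by rewrite mxE ltnn /= -scalerBr mulrC.
rewrite phic mulr_suml; apply: eq_bigr => k _.
rewrite mxE /= ltnSn eqxx mulrC [C k *: _]mulrC mulrA; congr (_ * _).
rewrite /C /cofactor; congr (_ * \det _); apply/matrixP => i j; rewrite !mxE.
have ne : (lift i0 i == i0) = false by apply/negbTE; rewrite eq_sym neq_lift.
(* Off row [m], the tests [< m] and [< m.+1] agree. *)
by rewrite ne /= ltnS [(bump m i <= m)%N]leq_eqVlt eq_sym (negPf (neq_bump _ _)).
Qed.

(** * The sign of Jain's determinant *)

Lemma is_derive_Jain_quotient (R : realType) (v w alpha t : R) :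
  0 < t -> 0 < v -> 0 < w ->
  is_derive t 1 (fun s => (1 + s * w) `^ alpha * (1 + s * v) `^ (- alpha))
    ((1 + t * v) `^ (- alpha - 1) * (alpha * (w - v)) * (1 + t * w) `^ (alpha - 1)).
Proof.
move=> t0 v0 w0.
have pos (z : R) : 0 < z -> 0 < 1 + t * z by move=> z0; rewrite addr_gt0// mulr_gt0.
have D (z : R) (z0 : 0 < z) b : is_derive t 1 (fun s => (1 + s * z) `^ b)
    (b * (1 + t * z) `^ (b - 1) * z).
  have dl : is_derive t 1 (fun s => 1 + s * z) z.
    have -> : (fun s : R => 1 + s * z) = (cst 1 : R -> R) + z *: (id : R -> R)
      by apply/funext => s; rewrite mulrC.
    have := is_deriveD (is_derive_cst (1 : R) t 1) (is_deriveZ z (is_derive_id t (1 : R))).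
    by rewrite add0r /GRing.scale/= mulr1.
  exact: (@is_derive1_comp R (@powR R ^~ b) (fun s => 1 + s * z) t _ _
    (is_derive1_powR b (pos z z0)) dl).
have := @is_deriveM _ _ _ _ t 1 _ _ (D w w0 alpha) (D v v0 (- alpha)).
move=> /is_derive_eq; apply.
(* With both exponents lowered by one, the claim reduces to [w * (1 + t * v) - v * (1 + t * w) = w -
   v]. *)
have P (z : R) : 0 < z -> forall b, (1 + t * z) `^ b = (1 + t * z) `^ (b - 1) * (1 + t * z).
  move=> z0 b; rewrite -[X in _ = _ * X](powRr1 (ltW (pos z z0))) -powRD ?subrK//.
  by rewrite (gt_eqF (pos z z0)) implybT.
rewrite /GRing.scale/= [(1 + t * w) `^ alpha]P// [(1 + t * v) `^ (- alpha)]P//.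
ring.
Qed.

Lemma sg_det_Jain (R : realType) (n : nat) (alpha : R) (u v : 'I_n.+1 -> R) :
  (forall i, 0 < u i) -> (forall i, 0 < v i) ->
  {homo u : i j / (i < j)%N >-> i < j} -> {homo v : i j / (i < j)%N >-> i < j} ->
  Num.sg (\det (\matrix_(j, k) (1 + u j * v k) `^ alpha)) =
  \prod_(i < n) Num.sg (alpha - i%:R) ^+ (n - i).
Proof.
elim: n => [|n IH] in alpha u v *; move=> u0 v0 ui vi.
  by rewrite det_mx11 mxE big_ord0 gtr0_sg// powR_gt0// addr_gt0// mulr_gt0.
have pos j k : 0 < 1 + u j * v k by rewrite addr_gt0// mulr_gt0.
pose g k (t : R) := (1 + t * v k) `^ alpha * (1 + t * v ord0) `^ (- alpha).
have -> : \matrix_(j, k) (1 + u j * v k) `^ alpha =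
    \matrix_(j, k) ((1 + u j * v ord0) `^ alpha * 1 * g k (u j)).
  apply/matrixP => j k; rewrite !mxE /g powRN mulr1 [RHS]mulrC mulfVK//.
  by rewrite gt_eqF// powR_gt0.
rewrite (det_scale_rows_cols _ _ _ (fun _ => 1)) det_col0_ones; last first.
  by move=> j; rewrite /g powRN mulfV// gt_eqF// powR_gt0.
pose a i := u (widen_ord (leqnSn n.+1) i).
pose b i := u (lift ord0 i).
pose v' i := v (lift ord0 i).
(* Row factor, column factor, and Jain entry of exponent [alpha - 1]. The [n.+1] columns each
   contribute one [alpha], which gives the factor of index 0 in the product; the induction
   hypothesis gives the others, shifted by one. *)
pose dg k (t : R) := (1 + t * v ord0) `^ (- alpha - 1) * (alpha * (v' k - v ord0)) *
  (1 + t * v' k) `^ (alpha - 1).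
have ab i : a i < b i by apply: ui; rewrite /= /bump add1n.
have [|xi [xiab ->]] := @det_mean_value R n.+1 (fun k => g (lift ord0 k)) dg a b ab.
  move=> i k t /andP[at_ _]; apply: is_derive_Jain_quotient => //.
  exact: (lt_le_trans (u0 _) at_).
have xi0 i : 0 < xi i by case/andP: (xiab i) => + _; apply: lt_trans; exact: u0.
rewrite (det_scale_rows_cols _ _ (fun i => (1 + xi i * v ord0) `^ (- alpha - 1))).
have -> : \prod_k (alpha * (v' k - v ord0)) = alpha ^+ n.+1 * \prod_k (v' k - v ord0).
  by rewrite big_split/= prodr_const card_ord.
have v'0 i : 0 < v' i by exact: v0.
rewrite !sgrM sgrX IH//; last 2 first.
(* Interlacing: for [i < j], [xi i < b i <= a j < xi j], with [b i = a j] when [j] is the successor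
   of [i]. *)
- move=> i j ij; case/andP: (xiab i) => _ /lt_trans; apply.
  case/andP: (xiab j) => + _; apply: le_lt_trans.
  have [E|ne] := eqVneq (lift ord0 i) (widen_ord (leqnSn n.+1) j); first by rewrite /b /a E.
  apply/ltW/ui; rewrite /= /bump add1n ltn_neqAle ij andbT.
  by apply: contra ne => /eqP E; apply/eqP/val_inj; rewrite /= /bump add1n.
- by move=> i j ij; apply: vi; rewrite /= /bump !add1n.
have S (m : nat) (F : 'I_m -> R) : (forall i, 0 < F i) -> Num.sg (\prod_i F i) = 1.
  by move=> F0; rewrite gtr0_sg// prodr_gt0.
have xv i : 0 < (1 + xi i * v ord0) `^ (- alpha - 1).
  by rewrite powR_gt0// addr_gt0// mulr_gt0.
have uv i : 0 < (1 + u i * v ord0) `^ alpha by rewrite powR_gt0.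
have ba i : 0 < b i - a i by rewrite subr_gt0.
have vv k : 0 < v' k - v ord0 by rewrite subr_gt0 vi.
rewrite !S// ?mul1r.
rewrite mulr1 big_ord_recl subr0 subn0; congr (_ * _).
apply: eq_bigr => i _; rewrite /= /bump add1n subSS -addn1 natrD.
by rewrite opprD addrCA addrC.
Qed.

(** * Signs of the minors of powers *)

Lemma incr_idx_leq (r p : nat) (f : 'I_r -> 'I_p) : incr_idx f -> (r <= p)%N.
Proof.
move=> fi; rewrite -(card_ord r) -(card_ord p); apply: (@leq_card _ _ f) => i j fij.
by case: (ltngtP i j) => [/fi|/fi|/val_inj//]; rewrite fij ltnn.
Qed.

(** All entries of such a [K] are positive, so the value of [rpow] at base 0 never enters, even for
    exponent 0; the form is inherited by submatrices on increasing indices. *)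
Definition Jain_factorization (R : realType) (p : nat) (K : 'I_p -> 'I_p -> R) : Prop :=
  exists c d u v : 'I_p -> R,
    [/\ forall i, 0 < c i /\ 0 < d i,
        forall i, 0 < u i /\ 0 < v i,
        {homo u : i j / (i < j)%N >-> i < j},
        {homo v : i j / (i < j)%N >-> i < j}
      & forall j k, K j k = c j * d k * (1 + u j * v k)].

Lemma sg_minor_Jain (R : realType) (p : nat) (K : 'I_p -> 'I_p -> R) (alpha : R)
    (r : nat) (f g : 'I_r -> 'I_p) :
  Jain_factorization R p K -> (0 < r)%N -> incr_idx f -> incr_idx g ->
  Num.sg (\det (\matrix_(j, k) rpow (K (f j) (g k)) alpha)) =
  \prod_(i < r.-1) Num.sg (alpha - i%:R) ^+ (r.-1 - i).
Proof.
move=> [c [d [u [v [cd0 uv0 ui vi KE]]]]].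
case: r f g => // r f g _ fi gi /=.
have ? i : 0 < c i by case: (cd0 i).
have ? i : 0 < d i by case: (cd0 i).
have ? i : 0 < u i by case: (uv0 i).
have ? i : 0 < v i by case: (uv0 i).
have pos j k : 0 < 1 + u j * v k by rewrite addr_gt0// mulr_gt0.
have -> : \matrix_(j, k) rpow (K (f j) (g k)) alpha =
    \matrix_(j, k) (c (f j) `^ alpha * d (g k) `^ alpha *
                    (1 + u (f j) * v (g k)) `^ alpha).
  apply/matrixP => j k; rewrite !mxE KE /rpow !mulr_gt0//.
  by rewrite !powRM// ?ltW// mulr_gt0.
have S (h : 'I_r.+1 -> 'I_p) (e : 'I_p -> R) : (forall i, 0 < e i) ->
    Num.sg (\prod_i e (h i) `^ alpha) = 1.
  by move=> e0; rewrite gtr0_sg// prodr_gt0// => i _; rewrite powR_gt0.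
rewrite (det_scale_rows_cols _ _ (fun i => c (f i) `^ alpha)).
rewrite !sgrM !S// !mul1r (@sg_det_Jain _ _ _ (u \o f) (v \o g))//=.
- by move=> i j ij; apply/ui/fi.
- by move=> i j ij; apply/vi/gi.
Qed.

Lemma minor_Jain_gt0 (R : realType) (p : nat) (K : 'I_p -> 'I_p -> R) (alpha : R) :
  Jain_factorization R p K -> p%:R - 2 < alpha ->
  TPmx (\matrix_(j, k) rpow (K j k) alpha).
Proof.
move=> KJ al r f g r0 fi gi; rewrite /minor -sgr_gt0.
under eq_mx do rewrite mxE.
rewrite (sg_minor_Jain _ _ _ _ _ _ _ KJ)// prodr_gt0// => i _.
(* An index [i < r.-1] satisfies [i + 2 <= r <= p], so every factor [alpha - i] is positive. *)
rewrite exprn_gt0// sgr_gt0 subr_gt0; apply: le_lt_trans al.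
rewrite lerBrDr -natrD ler_nat; have := incr_idx_leq _ _ _ fi; have := ltn_ord i.
by case: r r0 {f g fi gi i} (i : nat) => // r _ i /= ir rp; rewrite addn2 (leq_trans _ rp).
Qed.

Lemma minor_Jain_ge0 (R : realType) (p n : nat) (K : 'I_p -> 'I_p -> R) :
  Jain_factorization R p K -> TNmx (\matrix_(j, k) rpow (K j k) n%:R).
Proof.
move=> KJ r f g r0 fi gi; rewrite /minor -sgr_ge0.
under eq_mx do rewrite mxE.
rewrite (sg_minor_Jain _ _ _ _ _ _ _ KJ)//.
(* Minors of size at least [n + 2] contain the vanishing factor of index [n]; in smaller ones all
   indices are below [n]. *)
have [nr|nr] := ltnP n r.-1.
  rewrite (bigD1 (Ordinal nr))//= subrr sgr0 expr0n subn_eq0 leqNgt nr /=.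
  by rewrite mul0r.
apply: prodr_ge0 => i _; rewrite exprn_ge0// sgr_ge0 subr_ge0 ler_nat.
exact: leq_trans (ltnW (ltn_ord i)) nr.
Qed.

Lemma minor_Jain_lt0 (R : realType) (p : nat) (alpha : R) :
  0 < alpha -> alpha < p%:R - 2 -> ~ is_integer alpha ->
  exists r : nat, exists rp : (r <= p)%N, (0 < r)%N /\
    forall K : 'I_p -> 'I_p -> R, Jain_factorization R p K ->
    \det (\matrix_(j < r, k < r) rpow (K (widen_ord rp j) (widen_ord rp k)) alpha) < 0.
Proof.
move=> a0 ap aZ; pose n := Num.truncn alpha.
have /andP[na an] := truncn_itv (ltW a0).
have {}na : n%:R < alpha.
  by rewrite lt_neqAle na andbT; apply/eqP => E; apply: aZ; exists (n%:Z); rewrite -E.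
have rp : (n.+3 <= p)%N.
  by rewrite -(ltr_nat R) -addn2 natrD -ltrBrDr (lt_trans na).
(* At size [n.+3] the last index is [n.+1]: its factor is negative with exponent 1, while
   [n < alpha] makes all earlier factors positive. *)
exists n.+3, rp; split => // K KJ; rewrite -sgr_lt0 (sg_minor_Jain _ _ _ _ _ _ _ KJ)//.
rewrite /= big_ord_recr /= subSnn expr1 pmulr_rlt0 ?sgr_lt0 ?subr_lt0//.
apply: prodr_gt0 => i _; rewrite exprn_gt0// sgr_gt0 subr_gt0.
by apply: le_lt_trans na; rewrite ler_nat -ltnS.
Qed.

(** * Moving the arguments into the positivity region *)

Lemma finite_bound (R : realType) (p : nat) (x y : 'I_p -> R) :
  exists2 M : R, 0 < M & forall i, (- M < x i < M) /\ (- M < y i < M).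
Proof.
exists (1 + \sum_i (`|x i| + `|y i|)) => [|i].
  by rewrite ltr_wpDr// sumr_ge0// => i _; rewrite addr_ge0.
suff : `|x i| + `|y i| < 1 + \sum_i (`|x i| + `|y i|).
  by move=> h; rewrite -!ltr_norml; split; apply: le_lt_trans h; rewrite ?lerDl ?lerDr.
by rewrite (bigD1 i)//= addrCA ltrDl ltr_wpDr// sumr_ge0// => k _.
Qed.

(* Writing [x - y - a = (x + M) + (M - y)] and dividing by [M - y > 0]. *)
Lemma Jain_factorization_Omega (R : realType) (p : nat) (x y : 'I_p -> R) :
  inc setT x -> inc setT y ->
  exists a : R, Jain_factorization R p (fun j k => Omega (x j - y k - a)).
Proof.
move=> [_ xi] [_ yi]; have [M M0 bd] := finite_bound _ _ x y.
have xM j : 0 < x j + M by case: (bd j) => /andP[]; lra.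
have yM k : 0 < M - y k by case: (bd k) => _ /andP[]; lra.
exists (- (M + M)), (fun j => expR (- (x j + M))),
  (fun k => (M - y k) * expR (- (M - y k))), (fun j => x j + M),
  (fun k => (M - y k)^-1); split.
- by move=> i; rewrite mulr_gt0 ?expR_gt0.
- by move=> i; rewrite invr_gt0.
- by move=> i j /xi ij; rewrite ltrD2r.
- by move=> i j /yi ij; rewrite ltf_pV2 ?posrE// ltrD2l ltrN2.
move=> j k; have E : x j - y k - - (M + M) = (x j + M) + (M - y k) by ring.
rewrite /Omega E addr_gt0// opprD expRD.
have ne : M - y k != 0 by rewrite gt_eqF.
set e1 := expR _; set e2 := expR _; by field.
Qed.

(* [cos (X - Y) = cos X * cos Y * (1 + tan X * tan Y)] with [X, Y] in [(0, pi/2)]. *)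
Lemma Jain_factorization_Wfun (R : realType) (p : nat) (x y : 'I_p -> R) :
  inc setT x -> inc setT y ->
  exists2 m : R, 0 < m & Jain_factorization R p (fun j k => Wfun (m * (x j - y k))).
Proof.
move=> [_ xi] [_ yi]; have [M M0 bd] := finite_bound _ _ x y.
(* This scale sends [z + M], for [z] between [- M] and [M], into the interval from 0 to [pi / 2],
   where [cos] and [tan] are positive and [tan] increases; the shift by [M] cancels in
   [x j - y k]. *)
pose m : R := pi / 2 / (M + M).
have pi20 : 0 < pi / 2 :> R by rewrite divr_gt0// pi_gt0.
have MM : 0 < M + M by rewrite addr_gt0.
have m0 : 0 < m by rewrite divr_gt0.
have rg (z : R) : - M < z < M -> 0 < m * (z + M) < pi / 2.
  move=> /andP[z1 z2]; rewrite mulr_gt0//=; last by lra.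
  by rewrite -[X in _ < X](divfK (lt0r_neq0 MM)) ltr_pM2l//; lra.
have rgx j : 0 < m * (x j + M) < pi / 2 by apply: rg; case: (bd j).
have rgy j : 0 < m * (y j + M) < pi / 2 by apply: rg; case: (bd j).
have C (z : R) : 0 < z < pi / 2 -> 0 < cos z.
  by move=> z12; apply: cos_gt0_pihalf; lra.
have T (z : R) : 0 < z < pi / 2 -> 0 < tan z.
  by move=> /[dup] /C z0 z12; rewrite divr_gt0// sin_gt0_pihalf.
have I (z : R) : 0 < z < pi / 2 -> z \in `](- (pi / 2)), (pi / 2)[%R.
  by rewrite in_itv/=; lra.
exists m => //.
exists (fun j => cos (m * (x j + M))), (fun k => cos (m * (y k + M))),
  (fun j => tan (m * (x j + M))), (fun k => tan (m * (y k + M))); split.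
- by move=> i; split; apply: C.
- by move=> i; split; apply: T.
- by move=> i j /xi ij; rewrite ltr_tan ?I// ltr_pM2l// ltrD2r.
- by move=> i j /yi ij; rewrite ltr_tan ?I// ltr_pM2l// ltrD2r.
move=> j k; have E : m * (x j - y k) = m * (x j + M) - m * (y k + M) by ring.
have := C _ (rgx j); have := C _ (rgy k); rewrite /Wfun E.
rewrite ifT; last by have := rgx j; have := rgy k; lra.
rewrite cosB /tan => /lt0r_neq0 c1 /lt0r_neq0 c2; field.
by rewrite c1 c2.
Qed.

(** * From negative minors to the failure of total non-negativity *)

Lemma size_ge_inc (R : realType) (p : nat) (X : set R) :
  size_ge X p -> exists x : 'I_p -> R, inc X x.
Proof.
move=> [f [finj fX]]; pose s := sort <=%R (codom f).
have ss : size s = p by rewrite size_sort size_codom card_ord.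
exists (fun i => nth 0 s i); split.
  move=> i; have : nth 0 s i \in s by rewrite mem_nth// ss.
  by rewrite mem_sort => /codomP[k ->].
move=> i j ij; rewrite lt_sorted_ltn_nth ?inE ?ss// sort_lt_sorted.
by apply/injectiveP.
Qed.

Lemma inc_setT (R : realType) (p : nat) (X : set R) (x : 'I_p -> R) :
  inc X x -> inc setT x.
Proof. by case. Qed.

Lemma Jain_not_kernel_TN (R : realType) (p : nat) (X Y : set R) (x y : 'I_p -> R)
    (K : R -> R -> R) (alpha : R) :
  inc X x -> inc Y y -> Jain_factorization R p (fun j k => K (x j) (y k)) ->
  0 < alpha -> alpha < p%:R - 2 -> ~ is_integer alpha ->
  ~ kernel_TN p X Y (fun s t => rpow (K s t) alpha).
Proof.
move=> [xX xi] [yY yi] KJ a0 ap aZ TN.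
have [r [rp [r0 /(_ _ KJ)]]] := minor_Jain_lt0 _ _ _ a0 ap aZ.
rewrite ltNge => /negP; apply.
by apply: (TN r _ (x \o widen_ord rp) (y \o widen_ord rp)); rewrite ?r0//;
  split=> [i|i j ij] /=; [exact: xX | exact: xi | exact: yY | exact: yi].
Qed.

Lemma Jain_not_TNmx (R : realType) (p : nat) (K : 'I_p -> 'I_p -> R) (alpha : R) :
  Jain_factorization R p K ->
  0 < alpha -> alpha < p%:R - 2 -> ~ is_integer alpha ->
  ~ TNmx (\matrix_(j, k) rpow (K j k) alpha).
Proof.
move=> KJ a0 ap aZ TN.
have [r [rp [r0 /(_ _ KJ)]]] := minor_Jain_lt0 _ _ _ a0 ap aZ.
rewrite ltNge => /negP; apply.
have := TN r (widen_ord rp) (widen_ord rp) r0 (fun i j => id) (fun i j => id).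
by rewrite /minor; under eq_mx do rewrite mxE.
Qed.

Theorem theoremA (R : realType) (p : nat) (hp : (2 <= p)%N) :
  (forall X Y : set R, size_ge X p -> size_ge Y p ->
     (exists a : R, forall alpha : R,
        0 < alpha -> alpha < p%:R - 2 -> ~ is_integer alpha ->
        ~ kernel_TN p X Y (fun x y => rpow (Omega (x - y - a)) alpha))
  /\ (exists m : R, 0 < m /\ forall alpha : R,
        0 < alpha -> alpha < p%:R - 2 -> ~ is_integer alpha ->
        ~ kernel_TN p X Y (fun x y => rpow (Wfun (m * (x - y))) alpha)))
  /\
  (forall x y : 'I_p -> R, inc setT x -> inc setT y ->
     exists a : R, exists m : R, 0 < m /\
     forall alpha : R, 0 <= alpha ->
       let A := \matrix_(j < p, k < p) rpow (Omega (x j - y k - a)) alpha in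
       let B := \matrix_(j < p, k < p) rpow (Wfun (m * (x j - y k))) alpha in
       (p%:R - 2 < alpha -> TPmx A /\ TPmx B)
    /\ ((exists n : nat, (n <= p - 2)%N /\ alpha = n%:R) -> TNmx A /\ TNmx B)
    /\ (0 < alpha -> alpha < p%:R - 2 -> ~ is_integer alpha ->
          ~ TNmx A /\ ~ TNmx B)).
Proof.
split=> [X Y /size_ge_inc[x xX] /size_ge_inc[y yY] | x y xi yi].
  have [xT yT] := (inc_setT _ _ _ _ xX, inc_setT _ _ _ _ yY).
  (* The constants come from one choice of [p] points in each set, made before [alpha] is
     introduced, hence are uniform in [alpha]. *)
  have [a Ka] := Jain_factorization_Omega _ _ _ _ xT yT.
  have [m m0 Km] := Jain_factorization_Wfun _ _ _ _ xT yT.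
  split; [exists a | exists m; split=> //]; move=> alpha.
    exact: (Jain_not_kernel_TN _ _ _ _ _ _ (fun s t => Omega (s - t - a)) _ xX yY Ka).
  exact: (Jain_not_kernel_TN _ _ _ _ _ _ (fun s t => Wfun (m * (s - t))) _ xX yY Km).
have [a Ka] := Jain_factorization_Omega _ _ _ _ xi yi.
have [m m0 Km] := Jain_factorization_Wfun _ _ _ _ xi yi.
exists a, m; split=> // alpha _ A B; split; last split.
- move=> pa; split; [exact: minor_Jain_gt0 Ka pa | exact: minor_Jain_gt0 Km pa].
- move=> [n [_ En]]; rewrite /A /B En.
  split; [exact: minor_Jain_ge0 Ka | exact: minor_Jain_ge0 Km].
- move=> a0 ap aZ.
  split; [exact: Jain_not_TNmx Ka a0 ap aZ | exact: Jain_not_TNmx Km a0 ap aZ].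
Qed.
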